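(* Let $\mathscr{A}=(G,\partial)$ be a unicyclization of a connected graph $G$, let $\beta$ be a basis of $Z_1(G)=\ker\partial_1$, and let $\sigma$ be an edge of $G$. With $\lambda_\sigma(\mathscr{A})$, $\lambda_{-\sigma}(\mathscr{A})$, $\mathscr{A}_c,\beta_c$, $\mathscr{A}_d,\beta_d$ and $n_\sigma$ as in the context: 1. If $\sigma$ is a loop, then $\lambda_\sigma(\mathscr{A})=a\cdot[\sigma]\in\mathbb{Z}^{E(G)}$ for some $a\in\mathbb{Z}$. 2. If $\sigma$ is not a loop, then $[\lambda_\sigma(\mathscr{A})]_\beta=[\lambda(\mathscr{A}_c)]_{\beta_c}$. 3. If $\partial|_\sigma=\vec 0$, then $\lambda_{-\sigma}(\mathscr{A})=0$. 4. If $\partial|_\sigma\neq\vec 0$, then $[\lambda_{-\sigma}(\mathscr{A})]_\beta=n_\sigma\cdot[\lambda(\mathscr{A}_d)]_{\beta_d}$.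
   Context: Graphs are finite; loops and multiple edges are allowed. Fix an orientation of each edge; $[e]$ denotes the generator of $\mathbb{Z}^{E(G)}$ for the edge $e$. $\partial_1:\mathbb{Z}^{E(G)}\to\mathbb{Z}^{V(G)}$ is the (oriented) incidence matrix (a loop gives a zero column). $Z_1(G)=\ker\partial_1$ is, for $G$ connected, a free abelian group of rank $m=|E(G)|-|V(G)|+1$; bases are ordered $\mathbb{Z}$-bases. A unicyclizer of a connected graph $G$ is an integer matrix $\partial$ (rows indexed by $E(G)$) with (1) $\ker\partial=0$, (2) $\partial_1\partial=0$, (3) $\operatorname{rk}(\ker\partial_1/\operatorname{im}\partial)=1$. The pair $\mathscr{A}=(G,\partial)$ is a unicyclization of $G$. For a basis $\beta$ of $Z_1(G)$, $[\cdot]_\beta$ denotes coordinates with respect to $\beta$ (applied columnwise to $\partial$), and the winding number map of $\mathscr{A}$ relative to $\beta$ is $w_{\mathscr{A}}(z)=\det([z]_\beta,[\partial]_\beta)$. A cycletree of $G$ is a connected spanning subgraph $Y$ of $G$ containing exactly one cycle $C_Y$ (a loop, or a pair of parallel edges, may be that cycle). $\mathcal{U}(G)$ is the set of cycletrees. $z_Y\in Z_1(G)$ is the $\{0,\pm1\}$-vector of $C_Y$ with either orientation (irrelevant below). Put $\lambda(\mathscr{A})=\sum_{Y\in\mathcal{U}(G)}w_{\mathscr{A}}(z_Y)z_Y$, $\lambda_\sigma(\mathscr{A})=\sum_{Y\in\mathcal{U}(G),\,\sigma\in Y}w_{\mathscr{A}}(z_Y)z_Y$, $\lambda_{-\sigma}(\mathscr{A})=\sum_{Y\in\mathcal{U}(G),\,\sigma\notin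 Y}w_{\mathscr{A}}(z_Y)z_Y$. $\partial|_\sigma$ is the row of $\partial$ indexed by $\sigma$, and $n_\sigma$ (the winding difference) is the gcd of its entries. Contraction ($\sigma$ not a loop): $G_c=G/\sigma$ (remove $\sigma$, identify its ends). Deleting the $\sigma$-entry gives an isomorphism $Z_1(G)\to Z_1(G_c)$; $\beta_c$ is the image of $\beta$, and $\partial_c$ is defined by $[\partial_c]_{\beta_c}=[\partial]_\beta$. Then $\mathscr{A}_c=(G_c,\partial_c)$ is a unicyclization, with winding number map and $\lambda(\mathscr{A}_c)$ taken relative to $\beta_c$. Deletion ($\partial|_\sigma\neq\vec0$): $G_d=G-\sigma$ (delete $\sigma$; in this case $\sigma$ is not a bridge). $\mathscr{A}_d=(G_d,\partial_d)$ is a unicyclization with a basis $\beta_d$ of $Z_1(G_d)$ such that $[C]_\beta=[C_d]_{\beta_d}$ and $w_{\mathscr{A}}(C)=n_\sigma\cdot w_{\mathscr{A}_d}(C_d)$ for $C\in Z_1(G)$ with zero coefficient at $\sigma$, where $C_d$ is $C$ with the $\sigma$-entry deleted and $w_{\mathscr{A}_d}$ is relative to $\beta_d$. It is constructed by taking, without loss of generality (changing the basis changes winding numbers at most by a global sign), $\beta$ to be the fundamental cycles of a spanning tree $T$ not containing $\sigma$ (for each edge $e\notin T$, the unique cycle of $T\cup e$, with coefficient $1$ at $e$), with the cycle of $\sigma$ last; $\beta_d$ is obtained from $\beta$ by dropping the cycle of $\sigma$, and $\partial_d$ is defined by the matrix $\begin{pmatrix}[\partial_d]_{\beta_d}&*\\0\cdots0&n_\sigma\end{pmatrix}$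 obtained from $[\partial]_\beta$ by elementary integral column operations not changing the sign of the determinant. $\lambda(\mathscr{A}_d)$ is taken relative to $\beta_d$. *)

(* Defs.v *)
From HB Require Import structures.
From mathcomp Require Import all_boot all_order all_algebra.
From mathcomp Require classical_sets.

Set Implicit Arguments.
Unset Strict Implicit.
Unset Printing Implicit Defensive.

Import Order.TTheory GRing.Theory Num.Theory.
Local Open Scope ring_scope.

(* A Z-module is a zmodType; an integer acts by [*~]. *)

Section ZModules.
Variable A : zmodType.

Definition lincomb n (x : 'I_n -> A) (c : 'cV[int]_n) : A :=
  \sum_i x i *~ c i 0.

Definition indep_mod (I : A -> Prop) n (x : 'I_n -> A) : Prop :=
  forall c : 'cV[int]_n, I (lincomb x c) -> c = 0.

(* The quotient K / I has rank r: a maximal Z-independent family of K / I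
   has r elements. *)
Definition quotient_rank (K I : A -> Prop) (r : nat) : Prop :=
  (exists x : 'I_r -> A, (forall i, K (x i)) /\ indep_mod I x) /\
  (forall x : 'I_r.+1 -> A, (forall i, K (x i)) -> ~ indep_mod I x).

Definition Zbasis (K : A -> Prop) n (b : 'I_n -> A) : Prop :=
  [/\ forall i, K (b i),
      indep_mod (fun x => x = 0) b
    & forall x, K x -> exists c, x = lincomb b c].

(* [x]_b; only meaningful when b is independent and x is in its span. *)
Definition coords n (b : 'I_n -> A) (x : A) : 'cV[int]_n :=
  classical_sets.xget 0 (fun c => x = lincomb b c).

Definition coordmx n (b : 'I_n -> A) k (d : 'I_k -> A) : 'M[int]_(n, k) :=
  \matrix_(i, j) coords b (d j) i 0.

(* The family whose coordinate matrix with respect to b is M. *)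
Definition of_coordmx n (b : 'I_n -> A) k (M : 'M[int]_(n, k)) : 'I_k -> A :=
  fun j => lincomb b (col j M).

End ZModules.

Record graph := Graph {
  vert : finType;
  edge : finType;
  src : edge -> vert;
  tgt : edge -> vert }.

Arguments src {g} _.
Arguments tgt {g} _.

Definition chain (G : graph) := {ffun edge G -> int}.

Section Graphs.
Variable G : graph.
Implicit Types (e s : edge G) (v : vert G) (Y C T : {set edge G}) (x : chain G).

Definition boundary x : {ffun vert G -> int} :=
  [ffun v => \sum_(e | tgt e == v) x e - \sum_(e | src e == v) x e].

Definition Z1 x : Prop := boundary x = 0.

Definition edge_chain s : chain G := [ffun e => (e == s)%:R].

Definition adj Y : rel (vert G) := fun u v =>
  [exists e in Y, ((src e == u) && (tgt e == v)) ||
                  ((src e == v) && (tgt e == u))].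

(* An edge set stands for the spanning subgraph having these edges. *)
Definition connected Y : bool :=
  (0 < #|vert G|)%N && [forall u, forall v, connect (adj Y) u v].

Definition connected_graph : bool := connected [set: edge G].

(* A loop counts twice. *)
Definition degree C v : nat :=
  #|[set e in C | src e == v]| + #|[set e in C | tgt e == v]|.

(* Edge set of a nonempty connected 2-regular subgraph; its vertices are those
   of nonzero degree. *)
Definition is_cycle C : bool :=
  [&& C != set0,
      [forall v, (degree C v == 0%N) || (degree C v == 2%N)]
    & [forall u, forall v,
         (0 < degree C u)%N && (0 < degree C v)%N ==> connect (adj C) u v]].

Definition cycles_of Y : {set {set edge G}} :=
  [set C | is_cycle C & C \subset Y].

Definition cycletree Y : bool := connected Y && (#|cycles_of Y| == 1%N).

Definition spanning_tree T : bool := connected T && (#|cycles_of T| == 0%N).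

(* The {0,+1,-1}-vector of the cycle C, for one of its two orientations. *)
Definition cycle_vector C x : Prop :=
  Z1 x /\ forall e, `|x e| = (e \in C)%:R.

(* A choice z Y of an orientation of the cycle of every cycletree Y. *)
Definition cycle_choice (z : {set edge G} -> chain G) : Prop :=
  forall Y C, cycletree Y -> C \in cycles_of Y -> cycle_vector C (z Y).

(* An integer matrix with rows indexed by the edges is given by the family of
   its columns. *)

Section Unicyclizations.
Variables (k : nat) (d : 'I_k -> chain G).

Definition unicyclizer : Prop :=
  [/\ forall c : 'cV[int]_k, lincomb d c = 0 -> c = 0,
      forall j, boundary (d j) = 0
    & quotient_rank Z1 (fun x => exists c, x = lincomb d c) 1].

Definition diff_row s : 'rV[int]_k := \row_j d j s.

Definition winding_difference s : nat := \big[gcdn/0%N]_j `|d j s|%N.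

(* A unicyclizer of a connected graph has rank Z_1(G) - 1 columns, whence the
   size of b. *)
Variable b : 'I_k.+1 -> chain G.

Definition winding x : int :=
  \det (row_mx (coords b x) (coordmx b d) : 'M[int]_k.+1).

Variable z : {set edge G} -> chain G.

Definition lambda : chain G :=
  \sum_(Y | cycletree Y) z Y *~ winding (z Y).

Definition lambda_with s : chain G :=
  \sum_(Y | cycletree Y && (s \in Y)) z Y *~ winding (z Y).

Definition lambda_without s : chain G :=
  \sum_(Y | cycletree Y && (s \notin Y)) z Y *~ winding (z Y).

End Unicyclizations.

(* b lists, for every edge e i outside the spanning tree T, the cycle of
   T + e i. Either orientation is allowed (coefficient 1 or -1 at e i): a
   unicyclizer with a single column admits no column operation of determinant 1
   besides the identity, and its last row is positive for only one orientation
   of the last cycle. *)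
Definition fundamental_cycles T n (e : 'I_n -> edge G) (b : 'I_n -> chain G) :=
  [/\ spanning_tree T,
      injective e,
      [set e i | i : 'I_n] = ~: T
    & forall i, exists2 C, C \in cycles_of (e i |: T) & cycle_vector C (b i)].

Definition drop_edge s x : {ffun {e : edge G | e != s} -> int} :=
  [ffun f => x (val f)].

(* Contracting the non-loop s removes its target, identified with its source. *)

Section Contraction.
Variables (s : edge G) (nl : src s != tgt s).

Definition contract_vert v : {v : vert G | v != tgt s} :=
  insubd (exist (fun v => v != tgt s) (src s) nl) v.

Definition contract : graph :=
  @Graph {v : vert G | v != tgt s} {e : edge G | e != s}
    (fun f => contract_vert (src (val f))) (fun f => contract_vert (tgt (val f))).

Definition contract_basis n (b : 'I_n -> chain G) : 'I_n -> chain contract :=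
  fun i => drop_edge s (b i).

Definition contract_unicyclizer n (b : 'I_n -> chain G) k (d : 'I_k -> chain G) :
    'I_k -> chain contract :=
  of_coordmx (contract_basis b) (coordmx b d).

End Contraction.

Section Deletion.
Variable s : edge G.

Definition delete : graph :=
  @Graph (vert G) {e : edge G | e != s}
    (fun f => src (val f)) (fun f => tgt (val f)).

Variable k : nat.

(* For k > 0, these enumerate the first k of the k + 1 rows and the first k - 1
   of the k columns; they are only used in that case. *)
Definition row_emb : 'I_k.-1.+1 -> 'I_k.+1 :=
  @widen_ord k.-1.+1 k.+1 (leq_pred k).
Definition col_emb : 'I_k.-1 -> 'I_k := widen_ord (leq_pred k).

Variables (b : 'I_k.+1 -> chain G) (d : 'I_k -> chain G) (U : 'M[int]_k).

(* The matrix of d after the column operations U; those not changing the sign of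
   determinants have det U = 1. *)
Definition reduced_mx : 'M[int]_(k.+1, k) := coordmx b d *m U.

(* The last row of M is (0 ... 0 n). *)
Definition last_row_reduced (M : 'M[int]_(k.+1, k)) (n : nat) : Prop :=
  forall j : 'I_k, M ord_max j = if j.+1 == k then n%:Z else 0.

Definition delete_basis : 'I_k.-1.+1 -> chain delete :=
  fun i => drop_edge s (b (row_emb i)).

Definition delete_unicyclizer : 'I_k.-1 -> chain delete :=
  of_coordmx delete_basis (mxsub row_emb col_emb reduced_mx).

End Deletion.

End Graphs.

(* Main.v *)
(** The cycle space of a connected spanning subgraph Y, i.e. the set of chains
    of Z_1 supported in Y, is infinite cyclic exactly when Y is a cycletree, and
    then it is generated by z_Y.  Dropping the s-entry identifies the cycle
    space of a subgraph containing the non-loop s with that of its contraction,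
    and the cycle space of a subgraph avoiding s with that of the same subgraph
    of the deletion.  So it matches cycletrees with cycletrees and, up to sign,
    z_Y with its counterpart, while z |-> w(z) z is even.  Winding numbers agree
    for the contraction by definition; for the deletion they differ by the
    factor n_s, by expansion of the determinant along its last row.  If the row
    of s is zero, all columns of the winding determinant of a z avoiding s are
    killed by the row vector of the s-entries of the basis, which is nonzero
    unless s is a bridge. *)

Require Import Defs.
From HB Require Import structures.
From mathcomp Require Import all_boot all_order all_algebra.
From mathcomp Require boolp classical_sets.
From mathcomp Require Import zify ring.

Set Implicit Arguments.
Unset Strict Implicit.
Unset Printing Implicit Defensive.

Import Order.TTheory GRing.Theory Num.Theory.
Local Open Scope ring_scope.

(** * Coordinates in Z-modules *)

Section Coordinates.
Variables (A : zmodType) (n : nat) (b : 'I_n -> A).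

Fact lincomb_is_zmod_morphism : zmod_morphism (@lincomb A n b).
Proof.
move=> c c'; rewrite /lincomb -sumrB; apply: eq_bigr => i _.
by rewrite !mxE mulrzBr.
Qed.

HB.instance Definition _ :=
  GRing.isZmodMorphism.Build 'cV[int]_n A (@lincomb A n b)
    lincomb_is_zmod_morphism.

Lemma lincomb_mulmx k (M : 'M[int]_(n, k)) (c : 'cV_k) :
  lincomb (of_coordmx b M) c = lincomb b (M *m c).
Proof.
rewrite /lincomb /of_coordmx /lincomb.
under eq_bigr do rewrite mulrz_suml.
rewrite exchange_big; apply: eq_bigr => i _ /=.
rewrite mxE mulrz_sumr; apply: eq_bigr => j _.
by rewrite mxE mulrzA.
Qed.

Hypothesis b_indep : indep_mod (fun x => x = 0) b.

Lemma lincomb_inj : injective (lincomb b).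
Proof.
move=> c c' cc'; apply/eqP; rewrite -subr_eq0; apply/eqP/b_indep.
by rewrite raddfB /= cc' subrr.
Qed.

Lemma coords_lincomb c : coords b (lincomb b c) = c.
Proof.
apply: lincomb_inj.
by rewrite -(classical_sets.xgetPex 0 (P := fun c' => _ = lincomb b c')) //; exists c.
Qed.

Lemma coordsK x : (exists c, x = lincomb b c) -> lincomb b (coords b x) = x.
Proof. by case=> c ->; rewrite coords_lincomb. Qed.

(** The span of [b] is closed under negation, so off the span [x] and [- x] both get the default
    coordinates 0. *)
Lemma coordsN x : coords b (- x) = - coords b x.
Proof.
have [[c ->]|nx] := boolp.pselect (exists c, x = lincomb b c).
  by rewrite -raddfN /= !coords_lincomb.
rewrite /coords !classical_sets.xgetPN ?oppr0 // => c.
  by move=> xc; apply: nx; exists c.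
by move=> /eqP; rewrite eqr_oppLR -raddfN => /eqP xc; apply: nx; exists (- c).
Qed.

Lemma col_coordmx k (d : 'I_k -> A) j : col j (coordmx b d) = coords b (d j).
Proof. by apply/colP => i; rewrite !mxE. Qed.

Lemma coordmx_of_coordmx k (M : 'M[int]_(n, k)) : coordmx b (of_coordmx b M) = M.
Proof.
by apply/matrixP => i j; rewrite mxE /of_coordmx coords_lincomb mxE.
Qed.

Lemma of_coordmxK k (d : 'I_k -> A) :
  (forall j, exists c, d j = lincomb b c) -> of_coordmx b (coordmx b d) =1 d.
Proof. by move=> db j; rewrite /of_coordmx col_coordmx coordsK. Qed.

End Coordinates.

Lemma raddf_lincomb (A B : zmodType) (f : {additive A -> B}) n (b : 'I_n -> A) c :
  f (lincomb b c) = lincomb (f \o b) c.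
Proof. by rewrite raddf_sum; apply: eq_bigr => i _; rewrite raddfMz. Qed.

Lemma eq_lincomb (A : zmodType) n (b b' : 'I_n -> A) c :
  b =1 b' -> lincomb b c = lincomb b' c.
Proof. by move=> bb'; apply: eq_bigr => i _; rewrite bb'. Qed.

(** * Changes of basis of determinant 1 *)

Section ChangeOfBasis.
Variables (A : zmodType) (K : A -> Prop) (n : nat) (b b' : 'I_n -> A).
Hypotheses (bK : Zbasis K b) (b'K : forall i, K (b' i)).

Let b_indep : indep_mod (fun x => x = 0) b. Proof. by case: bK. Qed.

Lemma lincomb_coordmx c : lincomb b' c = lincomb b (coordmx b b' *m c).
Proof.
rewrite -lincomb_mulmx; apply: eq_lincomb => j.
by rewrite of_coordmxK // => i; case: bK => _ _; apply.
Qed.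

Hypothesis det_b' : \det (coordmx b b') = 1.

Let unit_b' : coordmx b b' \in unitmx.
Proof. by rewrite unitmxE det_b' unitr1. Qed.

Lemma Zbasis_change : Zbasis K b'.
Proof.
split=> // [c /eqP|x Kx].
  rewrite lincomb_coordmx -(raddf0 (lincomb b)) => /eqP/(lincomb_inj b_indep).
  by move/(congr1 (mulmx (invmx (coordmx b b')))); rewrite mulKmx // mulmx0.
case: bK => _ _ /(_ x Kx)[c ->]; exists (invmx (coordmx b b') *m c).
by rewrite lincomb_coordmx mulKVmx.
Qed.

Lemma coords_change x : K x -> coords b x = coordmx b b' *m coords b' x.
Proof.
move=> Kx; have [_ b'_indep b'_span] := Zbasis_change.
by rewrite -{1}(coordsK b'_indep (b'_span x Kx)) lincomb_coordmx coords_lincomb.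
Qed.

Lemma coordmx_change k (d : 'I_k -> A) : (forall j, K (d j)) ->
  coordmx b d = coordmx b b' *m coordmx b' d.
Proof.
move=> Kd; apply/matrixP => i j; rewrite mxE coords_change // !mxE.
by apply: eq_bigr => l _; rewrite !mxE.
Qed.

End ChangeOfBasis.

(** * Determinants for winding numbers *)

Lemma det_row_mxN n (c : 'cV[int]_n.+1) (M : 'M_(n.+1, n)) :
  \det (row_mx (- c) M : 'M_n.+1) = - \det (row_mx c M : 'M_n.+1).
Proof.
have -> : row_mx (- c) M = row_mx c M *m block_mx (-1)%:M 0 0 1%:M :> 'M_n.+1.
  by rewrite mul_row_block !mulmx0 mulmx1 addr0 add0r mul_mx_scalar scaleN1r.
by rewrite det_mulmx (@det_ublock _ 1 n) det1 det_scalar expr1 mulr1 mulrN1.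
Qed.

(** Column operations on a unicyclizer touch every column of the winding matrix but the first: they
    act as the block matrix diag(1, U). *)
Lemma det_row_mx_mulr n (c : 'cV[int]_n.+1) (M : 'M_(n.+1, n)) (U : 'M_n) :
  \det U = 1 ->
  \det (row_mx c (M *m U) : 'M_n.+1) = \det (row_mx c M : 'M_n.+1).
Proof.
move=> detU.
have -> : row_mx c (M *m U) = row_mx c M *m block_mx 1%:M 0 0 U :> 'M_n.+1.
  by rewrite mul_row_block !mulmx0 mulmx1 addr0 add0r.
by rewrite det_mulmx (@det_ublock _ 1 n) det1 detU !mulr1.
Qed.

(** Multiplying by the adjugate gives det M * r = 0, and the integers have no zero divisors. *)
Lemma det_row_killed n (M : 'M[int]_n) (r : 'rV_n) :
  r != 0 -> r *m M = 0 -> \det M = 0.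
Proof.
move=> r0 rM; apply/eqP; apply: contraNT r0 => detM.
have : \det M *: r = 0.
  by rewrite -mul_mx_scalar -mul_mx_adj mulmxA rM mul0mx.
by move/eqP; rewrite scalemx_eq0 (negPf detM).
Qed.

Lemma ffun_intMz (T : finType) (x : {ffun T -> int}) (a : int) e :
  (x *~ a) e = x e * a.
Proof. by rewrite ffunMzE mulrzz. Qed.

(** * Chains, connectivity and cycles of a graph *)

Section Chains.
Variable G : graph.
Implicit Types (e f s : edge G) (u v w : vert G) (Y C : {set edge G}).
Implicit Types (x y : chain G).

Fact boundary_is_zmod_morphism : zmod_morphism (@boundary G).
Proof.
move=> x y; apply/ffunP => v; rewrite !ffunE.
under eq_bigr do rewrite !ffunE; rewrite sumrB.
under [X in _ - X = _]eq_bigr do rewrite !ffunE; rewrite sumrB.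
by rewrite !opprD !opprK addrACA.
Qed.

HB.instance Definition _ :=
  GRing.isZmodMorphism.Build (chain G) {ffun vert G -> int} (@boundary G)
    boundary_is_zmod_morphism.

Fact drop_edge_is_zmod_morphism s : zmod_morphism (@drop_edge G s).
Proof. by move=> x y; apply/ffunP => e; rewrite !ffunE. Qed.

HB.instance Definition _ s :=
  GRing.isZmodMorphism.Build (chain G) {ffun {e | e != s} -> int}
    (@drop_edge G s) (drop_edge_is_zmod_morphism s).

Lemma lincombE n (b : 'I_n -> chain G) c e :
  lincomb b c e = \sum_i b i e * c i 0.
Proof. by rewrite sum_ffunE; apply: eq_bigr => i _; rewrite ffun_intMz. Qed.

Lemma Z1B x y : Z1 x -> Z1 y -> Z1 (x - y).
Proof. by rewrite /Z1 raddfB /= => -> ->; rewrite subrr. Qed.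

Lemma Z1Mz x a : Z1 x -> Z1 (x *~ a).
Proof. by rewrite /Z1 raddfMz /= => ->; rewrite mul0rz. Qed.

Lemma Z1P x : Z1 x <->
  forall v, \sum_(e | tgt e == v) x e = \sum_(e | src e == v) x e.
Proof.
split=> [/ffunP Zx v|Zx]; last by apply/ffunP => v; rewrite !ffunE Zx subrr.
by have := Zx v; rewrite !ffunE => /eqP; rewrite subr_eq0 => /eqP.
Qed.

Lemma boundary_edge_chain e :
  boundary (edge_chain e) = [ffun v => (tgt e == v)%:R - (src e == v)%:R].
Proof.
apply/ffunP => v; rewrite !ffunE.
have sumE (g : edge G -> vert G) :
    \sum_(f | g f == v) edge_chain e f = (g e == v)%:R :> int.
  rewrite big_mkcond (bigD1 e) //= big1 => [|f /negPf fe].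
    by rewrite ffunE eqxx addr0; case: eqP.
  by rewrite ffunE fe; case: eqP.
by rewrite !sumE.
Qed.

Lemma adj_sym Y : symmetric (adj Y).
Proof.
by move=> u v; apply: eq_existsb => e; rewrite orbC.
Qed.

Lemma connect_adj_sym Y : connect_sym (adj Y).
Proof. exact/sym_connect_sym/adj_sym. Qed.

Lemma adjP Y u v : reflect
  (exists2 e, e \in Y & (src e = u /\ tgt e = v) \/ (src e = v /\ tgt e = u))
  (adj Y u v).
Proof.
apply: (iffP existsP) => -[e].
  by case/andP=> eY /orP[]/andP[/eqP ? /eqP ?]; exists e => //; [left|right].
by move=> eY [][<- <-]; exists e; rewrite eY !eqxx ?orbT.
Qed.

Lemma adj_edge Y e : e \in Y -> adj Y (src e) (tgt e).
Proof. by move=> eY; apply/adjP; exists e; [|left]. Qed.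

Lemma connect_adjS Y Y' : Y \subset Y' ->
  subrel (connect (adj Y)) (connect (adj Y')).
Proof.
move=> YY'; apply: connect_sub => u v /adjP[e eY uv]; apply: connect1.
by apply/adjP; exists e => //; apply: (subsetP YY').
Qed.

Definition supported Y x := forall e, e \notin Y -> x e = 0.

Lemma supportedB Y x y : supported Y x -> supported Y y -> supported Y (x - y).
Proof. by move=> Yx Yy e eY; rewrite !ffunE Yx // Yy // subrr. Qed.

Lemma supportedMz Y x a : supported Y x -> supported Y (x *~ a).
Proof. by move=> Yx e eY; rewrite ffun_intMz Yx // mul0r. Qed.

(* Otherwise e is the only edge leaving the component of tgt e, so the net flow
   x e out of that component is not 0. *)
Lemma flow_edge_connect (R : zmodType) Y (x : edge G -> R) e :
  (forall f, f \notin Y -> x f = 0) ->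
  (forall v, \sum_(f | tgt f == v) x f = \sum_(f | src f == v) x f) ->
  x e != 0 -> connect (adj (Y :\ e)) (tgt e) (src e).
Proof.
move=> Yx flow xe; apply: contraNT xe => esrc.
pose A := [pred v | connect (adj (Y :\ e)) (tgt e) v].
have sumA (g : edge G -> vert G) :
    \sum_f x f *+ (g f \in A) = \sum_(v in A) \sum_(f | g f == v) x f.
  rewrite (exchange_big_dep xpredT) //=; apply: eq_bigr => f _.
  have [gA|gA] := boolP (g f \in A).
    rewrite (big_pred1 (g f)) // => v.
    by rewrite /= [g f == v]eq_sym andb_idl // => /eqP->.
  by rewrite big_pred0 // => v; apply: contraNF gA => /andP[vA /eqP->].
have : \sum_f (x f *+ (tgt f \in A) - x f *+ (src f \in A)) = 0.
  by rewrite sumrB !sumA (eq_bigr _ (fun v _ => flow v)) subrr.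
rewrite (bigD1 e) //= big1 => [|f fe].
  by rewrite !inE connect0 (negPf esrc) subr0 addr0 mulr1n => ->.
have [fY|/Yx->] := boolP (f \in Y); last by rewrite !mul0rn subrr.
have fA : adj (Y :\ e) (src f) (tgt f) by rewrite adj_edge // !inE fe.
rewrite !inE (same_connect_r (@connect_adj_sym _) (connect1 fA)) subrr //.
Qed.

(** Along a path from u to v, the edges are summed with the sign of their traversal, so that the
    boundary telescopes. *)
Lemma connect_chain Y u v : connect (adj Y) u v ->
  exists2 x, supported Y x & boundary x = [ffun w => (v == w)%:R - (u == w)%:R].
Proof.
case/connectP => p; elim: p u => [|u' p IHp] u /= => [_ ->|].
  exists 0 => [e _|]; first by rewrite ffunE.
  by rewrite raddf0; apply/ffunP => w; rewrite !ffunE subrr.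
case/andP=> /adjP[e eY uu'] up /(IHp u' up)[x Yx xE].
have Ye : supported Y (edge_chain e).
  by move=> f fY; rewrite ffunE; case: eqP fY => // ->; rewrite eY.
case: uu' => -[eu eu']; [exists (x - - edge_chain e)|exists (x - edge_chain e)].
- by apply: supportedB => // f fY; rewrite ffunE Ye // oppr0.
- rewrite raddfB raddfN /= xE boundary_edge_chain eu eu'; apply/ffunP => w.
  by rewrite !ffunE; ring.
- exact: supportedB.
- rewrite raddfB /= xE boundary_edge_chain eu eu'; apply/ffunP => w.
  by rewrite !ffunE; ring.
Qed.

(** The path from the target of e back to its source avoids e, so closing it up by e leaves the
    coefficient 1 at e. *)
Lemma edge_cycle_chain Y e : connect (adj (Y :\ e)) (tgt e) (src e) ->
  exists x, [/\ Z1 x, supported (e |: Y) x & x e = 1].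
Proof.
case/connect_chain => x Yx xE; exists (x - - edge_chain e); split.
- rewrite /Z1 raddfB raddfN /= xE boundary_edge_chain; apply/ffunP => w.
  by rewrite !ffunE; ring.
- move=> f; rewrite !inE negb_or => /andP[/negPf fe fY].
  by rewrite !ffunE fe Yx ?subr0 // !inE negb_and fY orbT.
- by rewrite !ffunE eqxx Yx ?sub0r ?opprK // !inE eqxx.
Qed.

Lemma degreeU1 C e v : e \notin C ->
  degree (e |: C) v = (degree C v + (src e == v) + (tgt e == v))%N.
Proof.
have cardE (g : edge G -> vert G) : e \notin C ->
    #|[set f in e |: C | g f == v]| = ((g e == v) + #|[set f in C | g f == v]|)%N.
  move=> eC; have -> : [set f in e |: C | g f == v] =
      if g e == v then e |: [set f in C | g f == v]
      else [set f in C | g f == v].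
    apply/setP => f; case: ifP => ge; rewrite !inE; case: eqP => //= ->.
      by rewrite ge.
    by rewrite ge andbF.
  by case: ifP; rewrite // cardsU1 inE (negPf eC).
by move=> eC; rewrite /degree !cardE //; lia.
Qed.

Lemma degree0 v : degree (@set0 (edge G)) v = 0%N.
Proof.
by rewrite /degree !eq_card0 // => e; rewrite !inE.
Qed.

Lemma degree_endpoint C e : e \in C ->
  (0 < degree C (src e))%N && (0 < degree C (tgt e))%N.
Proof.
move=> eC; rewrite -(setD1K eC) !degreeU1 ?setD11 // !eqxx; lia.
Qed.

(* The flow in question is the indicator of C with coefficients modulo 2. *)
Lemma cycle_edge_connect C e : is_cycle C -> e \in C ->
  connect (adj (C :\ e)) (tgt e) (src e).
Proof.
case/and3P=> _ /forallP Cdeg _ eC.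
apply: (@flow_edge_connect 'F_2 C (fun f => (f \in C)%:R)) => [f /negPf->//|v|].
  have sumE (g : edge G -> vert G) : \sum_(f | g f == v) ((f \in C)%:R : 'F_2) =
      #|[set f in C | g f == v]|%:R.
    rewrite -sum1_card natr_sum big_mkcond [RHS]big_mkcond; apply: eq_bigr => f _.
    by rewrite !inE andbC; case: eqP => //; case: (f \in C).
  have : (degree C v)%:R = 0 :> 'F_2 by case/orP: (Cdeg v) => /eqP->; apply/val_inj.
  rewrite !sumE natrD => /eqP; rewrite addr_eq0 => /eqP->.
  by rewrite oppr_pchar2 // pchar_Fp.
by rewrite eC oner_eq0.
Qed.

Lemma cycle_edge_chain C e : is_cycle C -> e \in C ->
  exists x, [/\ Z1 x, supported C x & x e = 1].
Proof.
move=> Ccyc eC; have [x] := edge_cycle_chain (cycle_edge_connect Ccyc eC).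
by rewrite (setUidPr _) ?sub1set //; exists x.
Qed.

Lemma path_edge_set Y u p : path (adj Y) u p -> uniq (u :: p) ->
  exists P : {set edge G}, [/\ P \subset Y,
    forall w, (degree P w + (u == w) + (last u p == w) = 2 * (w \in u :: p))%N
    & forall w, w \in u :: p -> connect (adj P) u w].
Proof.
elim: p u => [|v p IHp] u /= => [_ _|].
  exists set0; split=> [|w|w]; first exact: sub0set.
    by rewrite degree0 inE eq_sym; case: eqP.
  by rewrite inE => /eqP->.
case/andP=> uv vp /andP[uvp /(IHp v vp)[P [PY Pdeg Pconn]]].
have [e eY euv] := adjP _ _ _ uv.
(* As u lies off the rest of the path, no edge of [P] meets u; hence e, which does, is not in
   [P]. *)
have Pu0 : degree P u = 0%N by have := Pdeg u; rewrite (negPf uvp); lia.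
have eP : e \notin P.
  by apply/negP => /degree_endpoint; case: euv => -[-> ->]; rewrite Pu0 ?andbF.
have uvP : adj (e |: P) u v by apply/adjP; exists e; rewrite ?setU11.
exists (e |: P); split=> [|w|w].
- by rewrite subUset sub1set eY.
- have := Pdeg w; rewrite degreeU1 // [w \in u :: _]in_cons (eq_sym w u).
  have := uvp; case: (eqVneq u w) => [<- /negPf->|/negPf uw _].
    by case: euv => -[-> ->]; rewrite ?eqxx; lia.
  by case: euv => -[-> ->]; rewrite uw !addn0.
- rewrite in_cons => /predU1P[->|/Pconn vw]; first exact: connect0.
  apply: (connect_trans (connect1 uvP)).
  by apply: connect_adjS vw; apply: subsetUr.
Qed.

(** The path joining the ends of e can be taken simple, and closed up by e it is 2-regular. If e is
    a loop, the path is empty and the cycle is e alone. *)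
Lemma connect_cycle Y e : connect (adj (Y :\ e)) (tgt e) (src e) ->
  exists2 C, is_cycle C & C \subset e |: Y.
Proof.
case/connectP => q /shortenP[p ep up _ srce].
have [P [PY Pdeg Pconn]] := path_edge_set ep up.
have eP : e \notin P by apply/negP => /(subsetP PY); rewrite !inE eqxx.
have Cdeg w : degree (e |: P) w = (2 * (w \in tgt e :: p))%N.
  by rewrite -Pdeg degreeU1 // -srce; lia.
have Cconn w : (0 < degree (e |: P) w)%N -> connect (adj (e |: P)) (tgt e) w.
  rewrite Cdeg; case: (boolP (w \in _)) => // /Pconn ew _.
  by apply: connect_adjS ew; apply: subsetUr.
exists (e |: P); last exact/setUS/(subset_trans PY)/subsetDl.
apply/and3P; split.
- by apply/set0Pn; exists e; rewrite setU11.
- by apply/forallP => w; rewrite Cdeg; case: (_ \in _).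
- apply/forallP => u; apply/forallP => v; apply/implyP => /andP[/Cconn + /Cconn].
  by rewrite connect_adj_sym; apply: connect_trans.
Qed.

(** A cycle chain is a flow on its own support, which therefore joins the ends of e without using
    e. *)
Lemma support_cycle x e : Z1 x -> x e != 0 ->
  exists2 C, is_cycle C & forall f, f \in C -> x f != 0.
Proof.
move=> Zx xe; pose S := [set f | x f != 0].
have /connect_cycle[C Ccyc CS] : connect (adj (S :\ e)) (tgt e) (src e).
  apply: flow_edge_connect xe => [f|]; first by rewrite inE negbK => /eqP.
  exact/Z1P.
exists C => // f /(subsetP CS); rewrite !inE => /predU1P[->|] //.
Qed.

(** * Generators of cycle spaces of subgraphs *)

Definition cycle_generator Y x :=
  [/\ Z1 x, supported Y x, x != 0
    & forall y, Z1 y -> supported Y y -> exists a : int, y = x *~ a].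

Lemma chain_neq0 x : x != 0 -> exists e, x e != 0.
Proof.
move=> x0; apply/existsP; apply: contraNT x0; rewrite negb_exists => /forallP x0.
by apply/eqP/ffunP => e; have := x0 e; rewrite negbK ffunE => /eqP.
Qed.

Lemma cycle_vector_generator Y C x :
  cycles_of Y = [set C] -> cycle_vector C x -> cycle_generator Y x.
Proof.
move=> YC [Zx xC]; have : C \in cycles_of Y by rewrite YC set11.
rewrite inE => /andP[/and3P[/set0Pn[e eC] _ _] CY].
have xe : x e != 0 by rewrite -normr_gt0 xC eC.
have Yx : supported Y x.
  move=> f fY; have /negPf fC : f \notin C by apply: contra fY => /(subsetP CY).
  by apply/eqP; rewrite -normr_eq0 xC fC.
split=> // [|y Zy Yy]; first by apply: contraNneq xe => ->; rewrite ffunE.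
have xe2 : x e * x e = 1.
  by rewrite -expr2 -(real_normK (num_real _)) xC eC expr1n.
(* Since [x e] is 1 or -1, this multiple of [x] agrees with [y] at e. A nonzero difference would
   have a cycle of [Y] in its support; that cycle can only be [C], which contains e, where the
   difference vanishes. *)
exists (x e * y e); apply/eqP; rewrite -subr_eq0; apply/negPn/negP => yx.
have [f yxf] := chain_neq0 yx.
have [D Dcyc Dyx] := support_cycle (Z1B Zy (Z1Mz (x e * y e) Zx)) yxf.
have : D \in cycles_of Y.
  rewrite inE Dcyc; apply/subsetP => g /Dyx; apply: contraNT => gY.
  exact/eqP/(supportedB Yy (supportedMz _ Yx)).
rewrite YC => /set1P DC; have := Dyx e; rewrite DC => /(_ eC).
by rewrite !ffunE ffun_intMz mulrA xe2 mul1r subrr eqxx.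
Qed.

(** Every edge of a cycle D of [Y] has coefficient 1 in some cycle chain supported in D. That chain
    is a multiple of [x], so D is exactly the support of [x]; this leaves at most one cycle, and
    [support_cycle] provides one. *)
Lemma generator_cycletree Y x : connected Y -> cycle_generator Y x -> cycletree Y.
Proof.
move=> Yconn [Zx Yx x0 xgen]; rewrite /cycletree Yconn /=.
have [e xe] := chain_neq0 x0.
have [C Ccyc Cx] := support_cycle Zx xe.
have cyc_supp D : D \in cycles_of Y -> D = [set f | x f != 0].
  rewrite inE => /andP[Dcyc DY].
  have Dgen f : f \in D -> exists a : int,
      [/\ a != 0, x f != 0 & supported D (x *~ a)].
    move=> /(cycle_edge_chain Dcyc)[y [Zy Dy yf]].
    have [g gY|a ya] := xgen y Zy.
      by apply: Dy; apply: contra gY => /(subsetP DY).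
    have : x f * a != 0 by rewrite -ffun_intMz -ya yf.
    by rewrite mulf_eq0 negb_or => /andP[? ?]; exists a; rewrite -ya.
  apply/eqP; rewrite eqEsubset; apply/andP; split; apply/subsetP => f.
    by case/Dgen => a []; rewrite inE.
  have /and3P[/set0Pn[g /Dgen[a [a0 _ Dxa]]] _ _] := Dcyc.
  rewrite inE; apply: contraNT => /Dxa/eqP.
  by rewrite ffun_intMz mulf_eq0 (negPf a0) orbF.
apply/cards1P; exists [set f | x f != 0]; apply/eqP.
rewrite eqEsubset; apply/andP; split; apply/subsetP => D.
  by move/cyc_supp => ->; rewrite set11.
have CY : C \in cycles_of Y.
  rewrite inE Ccyc; apply/subsetP => f /Cx; apply: contraNT => fY.
  by rewrite Yx.
by rewrite -(cyc_supp _ CY) => /set1P->.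
Qed.

Lemma cycle_choice_generator z Y : cycle_choice z -> cycletree Y ->
  cycle_generator Y (z Y).
Proof.
move=> zc Yct; have /andP[_ /cards1P[C YC]] := Yct.
by apply: (cycle_vector_generator YC); apply: zc; rewrite // YC set11.
Qed.

(** Two generators are integer multiples of each other, so the factors are units of Z. *)
Lemma generator_opp Y x y : cycle_generator Y x -> cycle_generator Y y ->
  y = x \/ y = - x.
Proof.
move=> [Zx Yx x0 xgen] [Zy Yy _ ygen].
have [a ya] := xgen y Zy Yy; have [c xc] := ygen x Zx Yx.
have [e xe] := chain_neq0 x0.
have : x e * (a * c - 1) = 0.
  by rewrite mulrBr mulrA -!ffun_intMz -ya -xc mulr1z subrr.
move/eqP; rewrite mulf_eq0 (negPf xe) subr_eq0 => /eqP ac.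
have [a1|a1] : a = 1 \/ a = -1.
  by have /eqP := congr1 absz ac; rewrite abszM muln_eq1 => /andP[/eqP ? _]; lia.
  by left; rewrite ya a1.
by right; rewrite ya a1 mulrN1z.
Qed.

End Chains.

(** * Transfer of cycletrees and their sums between two graphs *)

Definition cycle_iso (G H : graph) (phi : chain G -> chain H)
    (Y : {set edge G}) (Y' : {set edge H}) :=
  [/\ forall x, Z1 x -> supported Y x -> Z1 (phi x) /\ supported Y' (phi x),
      forall x, Z1 x -> supported Y x -> phi x = 0 -> x = 0
    & forall y, Z1 y -> supported Y' y ->
        exists x, [/\ Z1 x, supported Y x & phi x = y]].

Lemma generator_transfer (G H : graph) (phi : {additive chain G -> chain H})
    (Y : {set edge G}) (Y' : {set edge H}) (x : chain G) :
  cycle_iso phi Y Y' -> Z1 x -> supported Y x ->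
  cycle_generator Y x <-> cycle_generator Y' (phi x).
Proof.
move=> [phiZ phi_inj phi_surj] Zx Yx.
split=> -[_ _ x0 xgen]; split=> //.
- by have [] := phiZ x Zx Yx.
- by have [] := phiZ x Zx Yx.
- by apply: contra_neq x0; apply: phi_inj.
- move=> y' Zy' Yy'; have [y [Zy Yy <-]] := phi_surj y' Zy' Yy'.
  by have [a ->] := xgen y Zy Yy; exists a; rewrite raddfMz.
- by apply: contra_neq x0 => ->; rewrite raddf0.
- move=> y Zy Yy; have [Zpy Ypy] := phiZ y Zy Yy.
  have [a ya] := xgen _ Zpy Ypy; exists a; apply/eqP; rewrite -subr_eq0.
  apply/eqP/phi_inj; first exact/Z1B/Z1Mz.
    exact/supportedB/supportedMz.
  by rewrite raddfB raddfMz /= ya subrr.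
Qed.

(** Common core of the contraction and deletion formulas: [P] selects the edge sets containing s, or
    those avoiding it; [h] and [g] translate edge sets between the two graphs; [n] is 1, or the
    winding difference. *)
Lemma lambda_transfer (G H : graph) (phi : {additive chain G -> chain H})
    (P : pred {set edge G}) (h : {set edge H} -> {set edge G})
    (g : {set edge G} -> {set edge H})
    (z : {set edge G} -> chain G) (zH : {set edge H} -> chain H)
    (w : chain G -> int) (wH : chain H -> int) (n : int) :
  cycle_choice z -> cycle_choice zH ->
  (forall Y', P (h Y')) -> cancel h g -> {in P, cancel g h} ->
  (forall Y', connected (h Y') = connected Y') ->
  (forall Y', cycle_iso phi (h Y') Y') ->
  (forall y, wH (- y) = - wH y) ->
  (forall Y' x, Z1 x -> supported (h Y') x -> w x = n * wH (phi x)) ->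
  phi (\sum_(Y | cycletree Y && P Y) z Y *~ w (z Y)) =
  (\sum_(Y' | cycletree Y') zH Y' *~ wH (zH Y')) *~ n.
Proof.
move=> zc zHc Ph hK gK hconn hiso wHN wE.
rewrite (reindex_onto h g) /= => [|Y /andP[_ PY]]; last exact: gK.
rewrite raddf_sum mulrz_suml; apply: eq_big => Y'.
  (* A connected edge set is a cycletree exactly when its cycle space has a generator, and [phi]
     carries generators both ways. *)
  rewrite Ph hK eqxx !andbT; apply/idP/idP => Yct.
    have xgen := cycle_choice_generator zc Yct; have [Zx Yx _ _] := xgen.
    apply: (@generator_cycletree _ _ (phi (z (h Y')))).
      by rewrite -hconn; case/andP: Yct.
    exact/(generator_transfer (hiso Y') Zx Yx).
  have ygen := cycle_choice_generator zHc Yct; have [Zy Yy _ _] := ygen.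
  have [_ _ /(_ _ Zy Yy)[x [Zx Yx xy]]] := hiso Y'.
  apply: (@generator_cycletree _ _ x); first by rewrite hconn; case/andP: Yct.
  by apply/(generator_transfer (hiso Y') Zx Yx); rewrite xy.
rewrite Ph hK eqxx !andbT => Yct.
have xgen := cycle_choice_generator zc Yct; have [Zx Yx _ _] := xgen.
have pgen := (generator_transfer (hiso Y') Zx Yx).1 xgen.
have Y'ct : cycletree Y'.
  by apply: generator_cycletree pgen; rewrite -hconn; case/andP: Yct.
rewrite raddfMz (wE Y') // mulrC mulrzA.
(* The chosen orientations may be opposite; the sign then occurs both in the chain and in its
   winding number, and cancels. *)
have [->|->] := generator_opp pgen (cycle_choice_generator zHc Y'ct) => //.
by rewrite wHN mulNrz mulrNz opprK.
Qed.

Lemma sum_Z1 (G : graph) (I : finType) (P : pred I) (x : I -> chain G)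
    (a : I -> int) : (forall i, P i -> Z1 (x i)) -> Z1 (\sum_(i | P i) x i *~ a i).
Proof.
move=> Zx; rewrite /Z1 raddf_sum big1 // => i Pi.
exact/Z1Mz/Zx.
Qed.

Lemma cycle_choice_Z1 (G : graph) (z : {set edge G} -> chain G) Y :
  cycle_choice z -> cycletree Y -> Z1 (z Y).
Proof. by move=> zc /(cycle_choice_generator zc)[]. Qed.

Lemma lambda_with_Z1 (G : graph) k (d : 'I_k -> chain G) b z s :
  cycle_choice z -> Z1 (lambda_with d b z s).
Proof. by move=> zc; apply: sum_Z1 => Y /andP[/(cycle_choice_Z1 zc)]. Qed.

Lemma lambda_without_Z1 (G : graph) k (d : 'I_k -> chain G) b z s :
  cycle_choice z -> Z1 (lambda_without d b z s).
Proof. by move=> zc; apply: sum_Z1 => Y /andP[/(cycle_choice_Z1 zc)]. Qed.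

Lemma windingN (G : graph) k (d : 'I_k -> chain G) b x :
  indep_mod (fun x => x = 0) b -> winding d b (- x) = - winding d b x.
Proof. by move=> b_indep; rewrite /winding coordsN // det_row_mxN. Qed.

(** A step may go to a path of any length: under contraction an edge can shrink to a point, and
    lifting back an edge can become a longer path. *)
Lemma connect_image (T T' : finType) (e : rel T) (e' : rel T') (f : T -> T') :
  (forall u v, e u v -> connect e' (f u) (f v)) ->
  forall u v, connect e u v -> connect e' (f u) (f v).
Proof.
move=> ee' u v /connectP[p]; elim: p u => [|w p IHp] u /= => [_ ->|].
  exact: connect0.
by case/andP=> /ee' uw wp /(IHp w wp); apply: connect_trans.
Qed.

(** * Dropping an edge, and deletion *)

Section DropEdge.
Variables (G : graph) (s : edge G).
Local Notation edge' := {e : edge G | e != s}.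
Implicit Types (D : {set edge'}) (x : chain G).

Definition lift_set D : {set edge G} := val @: D.
Definition drop_set (Y : {set edge G}) : {set edge'} := [set f | val f \in Y].

Lemma mem_lift_set D (f : edge') : (val f \in lift_set D) = (f \in D).
Proof. exact: (mem_imset _ _ val_inj). Qed.

Lemma notin_lift_set D : s \notin lift_set D.
Proof. by apply/imsetP => -[f _ sf]; have := valP f; rewrite -sf eqxx. Qed.

Lemma lift_setK : cancel lift_set drop_set.
Proof. by move=> D; apply/setP => f; rewrite inE mem_lift_set. Qed.

Lemma drop_setK : {in [pred Y : {set edge G} | s \notin Y], cancel drop_set lift_set}.
Proof.
move=> Y; rewrite [Y \in _]inE => sY; apply/setP => e.
apply/imsetP/idP => [[f + ->]|eY]; first by rewrite inE.
have es : e != s by apply: contraNneq sY => <-.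
by exists (Sub e es); rewrite ?inE SubK.
Qed.

Lemma edgeP (Q : edge G -> Prop) :
  Q s -> (forall f : edge', Q (val f)) -> forall e, Q e.
Proof.
by move=> Qs Qf e; have [->//|es] := eqVneq e s; rewrite -(SubK edge' es).
Qed.

Lemma sum_drop_edge (x : chain G) (Q : pred (edge G)) :
  \sum_(e | Q e) x e = (if Q s then x s else 0) +
    \sum_(f : edge' | Q (val f)) drop_edge s x f.
Proof.
have -> : \sum_(f : edge' | Q (val f)) drop_edge s x f =
    \sum_(e | Q e && (e != s)) x e.
  rewrite [RHS](reindex_omap (val : edge' -> edge G) insub) => [|e /andP[_ es]]; last first.
    by rewrite insubT.
  apply: eq_big => f; last by rewrite ffunE.
  by rewrite valK eqxx andbT (valP f) andbT.
case: ifP => Qs; first by rewrite (bigD1 s).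
by rewrite add0r; apply: eq_bigl => e; rewrite andb_idr // => Qe;
   apply: contraTneq Qe => ->; rewrite Qs.
Qed.

Definition extend_chain (y : {ffun edge' -> int}) : chain G :=
  [ffun e => if insub e is Some f then y f else 0].

Lemma extend_chain_val y (f : edge') : extend_chain y (val f) = y f.
Proof. by rewrite ffunE valK. Qed.

Lemma extend_chain_s y : extend_chain y s = 0.
Proof. by rewrite ffunE insubN // negbK. Qed.

Lemma extend_chainK y : drop_edge s (extend_chain y) = y.
Proof. by apply/ffunP => f; rewrite ffunE extend_chain_val. Qed.

Lemma drop_edge_edge_chain : drop_edge s (edge_chain s) = 0.
Proof. by apply/ffunP => f; rewrite !ffunE (negPf (valP f)). Qed.

Lemma drop_edge_inj x : x s = 0 -> drop_edge s x = 0 -> x = 0.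
Proof.
move=> xs /ffunP x0; apply/ffunP => e; rewrite ffunE; move: e.
by apply: edgeP => // f; have := x0 f; rewrite !ffunE.
Qed.

Lemma drop_edge_eq0 x : drop_edge s x = 0 -> x = edge_chain s *~ x s.
Proof.
move=> x0; apply/eqP; rewrite -subr_eq0; apply/eqP/drop_edge_inj.
  by rewrite !ffunE ffun_intMz ffunE eqxx mul1r subrr.
by rewrite raddfB raddfMz /= x0 drop_edge_edge_chain mul0rz subrr.
Qed.

Lemma drop_edge_supported D x :
  supported (s |: lift_set D) x ->
  forall f, f \notin D -> drop_edge s x f = 0.
Proof.
move=> Yx f fY; rewrite ffunE Yx // !inE mem_lift_set negb_or fY andbT.
exact: (valP f).
Qed.

Lemma boundary_delete x : x s = 0 ->
  boundary (drop_edge s x : chain (delete s)) = boundary x.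
Proof.
move=> xs; apply/ffunP => v; rewrite !ffunE !sum_drop_edge xs !if_same !add0r.
by [].
Qed.

Lemma Z1_delete x : x s = 0 -> Z1 (drop_edge s x : chain (delete s)) <-> Z1 x.
Proof. by move=> xs; rewrite /Z1 -boundary_delete. Qed.

Lemma connected_delete D : connected (lift_set D) = @connected (delete s) D.
Proof.
have adjE : adj (lift_set D) =2 @adj (delete s) D.
  move=> u v; apply/adjP/adjP => -[] => [e /imsetP[f fY ->] uv|f fY uv].
    by exists f.
  by exists (val f); rewrite ?mem_lift_set.
congr (_ && _); apply: eq_forallb => u; apply: eq_forallb => v.
exact: eq_connect.
Qed.

(** A chain supported away from s vanishes at s, so dropping that entry loses nothing and keeps the
    boundary. *)
Lemma cycle_iso_delete D :
  @cycle_iso G (delete s) (drop_edge s) (lift_set D) D.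
Proof.
split=> [x Zx Yx|x _ Yx|y Zy Yy].
- split; first by apply/Z1_delete; rewrite // Yx ?notin_lift_set.
  by move=> f fY; rewrite ffunE Yx // mem_lift_set.
- exact/drop_edge_inj/Yx/notin_lift_set.
- exists (extend_chain y); rewrite extend_chainK; split=> //.
    by apply/Z1_delete; rewrite ?extend_chain_s // extend_chainK.
  apply: edgeP => [_|f]; first exact: extend_chain_s.
  by rewrite mem_lift_set extend_chain_val; apply: Yy.
Qed.

End DropEdge.

(** * Contraction of an edge that is not a loop *)

Section Contract.
Variables (G : graph) (s : edge G) (nl : src s != tgt s).
Local Notation Gc := (contract nl).
Implicit Type x : chain G.
Local Notation cv := (contract_vert nl).

Lemma contract_vertE v : val (cv v) = if v != tgt s then v else src s.
Proof. by rewrite /contract_vert val_insubd. Qed.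

Lemma contract_vert_val v : cv (val v) = v.
Proof. by apply: val_inj; rewrite contract_vertE (valP v). Qed.

Lemma contract_vert_ends : cv (tgt s) = cv (src s).
Proof. by apply: val_inj; rewrite !contract_vertE eqxx nl. Qed.

(** The ends of s are merged, so s enters the inflow and the outflow of the same vertex and
    cancels. *)
Lemma boundary_contract x v' :
  boundary (drop_edge s x : chain Gc) v' =
  \sum_(v | cv v == v') boundary x v.
Proof.
have sumE (g : edge G -> vert G) :
    \sum_(v | cv v == v') \sum_(e | g e == v) x e = \sum_(e | cv (g e) == v') x e.
  rewrite (partition_big g (fun v => cv v == v')) //; apply: eq_bigr => v /eqP vv'.
  by apply: eq_bigl => e; rewrite andb_idl // => /eqP->; rewrite vv'.
under [RHS]eq_bigr do rewrite ffunE.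
rewrite sumrB !sumE !(sum_drop_edge s) contract_vert_ends opprD addrACA subrr add0r.
by rewrite ffunE.
Qed.

(** The only vertex of the contraction with two preimages is the one merging the ends of s. When the
    boundary vanishes at the target, the boundary at the merged vertex is the one at the source. *)
Lemma Z1_contract x : boundary x (tgt s) = 0 ->
  Z1 (drop_edge s x : chain Gc) <-> Z1 x.
Proof.
move=> xt; split=> [/ffunP Zx|Zx]; apply/ffunP => v; last first.
  by rewrite boundary_contract big1 ?ffunE // => u _; rewrite Zx ffunE.
have [->|vt] := eqVneq v (tgt s); first by rewrite xt ffunE.
have := Zx (Sub v vt); rewrite boundary_contract (bigD1 v) /=; last first.
  by rewrite -val_eqE contract_vertE vt /=.
rewrite big1 => [|u /andP[/eqP/(congr1 val)]]; first by rewrite addr0 !ffunE.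
by rewrite contract_vertE /=; case: eqP => [->|_ /= ->]; rewrite ?eqxx.
Qed.

(** A chain killed by [drop_edge s] is a multiple of s, and its boundary at the target of the
    non-loop s is that multiple. *)
Lemma Z1_contract_inj x : Z1 x -> drop_edge s x = 0 -> x = 0.
Proof.
move=> Zx x0; apply: (drop_edge_inj (s := s)) => //.
have := congr1 (fun y : {ffun vert G -> int} => y (tgt s)) Zx.
rewrite {1}(drop_edge_eq0 x0) raddfMz /= boundary_edge_chain ffunE.
rewrite ffun_intMz ffunE eqxx (negPf nl).
by rewrite subr0 mul1r.
Qed.

Lemma cycle_iso_contract (Y' : {set edge Gc}) :
  cycle_iso (drop_edge s : chain G -> chain Gc) (s |: lift_set Y') Y'.
Proof.
split=> [x Zx Yx|x Zx _|y Zy Yy].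
- split; last exact: drop_edge_supported.
  by apply/Z1_contract; rewrite // Zx ffunE.
- exact: Z1_contract_inj.
pose y0 := extend_chain y.
(* The s-entry is forced: it has to cancel the boundary of [y0] at the target of s. *)
exists (y0 - edge_chain s *~ boundary y0 (tgt s)).
have dropE : drop_edge s (y0 - edge_chain s *~ boundary y0 (tgt s)) = y.
  by rewrite raddfB raddfMz /= drop_edge_edge_chain mul0rz subr0 extend_chainK.
split=> //.
  apply/Z1_contract; last by rewrite dropE.
  rewrite raddfB raddfMz /= boundary_edge_chain !ffunE.
  rewrite ffun_intMz ffunE eqxx (negPf nl).
  by rewrite subr0 mul1r subrr.
apply: (edgeP (s := s)) => [|f]; first by move/negP; case; apply: setU11.
rewrite !inE negb_or mem_lift_set => /andP[fs fY].
rewrite ffunE extend_chain_val Yy // add0r ffunE ffun_intMz ffunE (negPf fs).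
by rewrite mul0r oppr0.
Qed.

Lemma connected_contract (Y' : {set edge Gc}) :
  connected (s |: lift_set Y') = connected Y'.
Proof.
rewrite /connected; have -> : (0 < #|vert G|)%N by apply/card_gt0P; exists (src s).
have -> : (0 < #|vert Gc|)%N by apply/card_gt0P; exists (cv (src s)).
set Y := s |: _; apply/forallP/forallP => conn u; apply/forallP => v.
  rewrite -(contract_vert_val u) -(contract_vert_val v).
  apply: (connect_image _ (forallP (conn (val u)) (val v))) => u' v' /adjP[e].
  move: e; apply: (edgeP (s := s)) => [_|f].
    by case=> -[<- <-]; rewrite contract_vert_ends.
  rewrite !inE mem_lift_set (negPf (valP f)) /= => fY.
  have uv := @adj_edge Gc Y' f fY.
  by case=> -[<- <-]; [|rewrite (@connect_adj_sym Gc)]; apply: connect1.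
(* The edge s joins each vertex to its representative within [Y], so walks of the contraction
   lift. *)
have cvK w : connect (adj Y) (val (cv w)) w.
  rewrite contract_vertE; case: eqP => //= ->.
  by rewrite connect1 // adj_edge // setU11.
have cvKr w : connect (adj Y) w (val (cv w)) by rewrite connect_adj_sym.
apply: connect_trans (cvK v); apply: (connect_trans (cvKr u)).
apply: connect_image (forallP (conn (cv u)) (cv v)) => u' v' /adjP[f fY].
have fE : connect (adj Y) (val (src f)) (val (tgt f)).
  apply: connect_trans (cvKr _); apply: (connect_trans (cvK _)).
  by rewrite connect1 // adj_edge // inE mem_lift_set fY orbT.
by case=> -[<- <-] //; rewrite connect_adj_sym.
Qed.

Lemma contract_setK :
  cancel (fun Y' : {set edge Gc} => s |: lift_set Y') (@drop_set G s).
Proof.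
by move=> Y'; apply/setP => f; rewrite !inE mem_lift_set (negPf (valP f)).
Qed.

Lemma drop_set_contractK :
  {in [pred Y : {set edge G} | s \in Y], cancel (@drop_set G s)
     (fun Y' : {set edge Gc} => s |: lift_set Y')}.
Proof.
move=> Y; rewrite [Y \in _]inE => sY; apply/setP; apply: (edgeP (s := s)) => [|f].
  by rewrite setU11 sY.
by rewrite !inE mem_lift_set (negPf (valP f)) inE.
Qed.

End Contract.

(** * Loops, contraction, zero rows and deletion: the four clauses *)

Lemma det_last_row n (A : 'M[int]_n.+1) :
  (forall j, j != ord_max -> A ord_max j = 0) ->
  \det A = A ord_max ord_max * \det (row' ord_max (col' ord_max A)).
Proof.
move=> A0; rewrite (expand_det_row A ord_max) (bigD1 ord_max) //= big1 => [|j /A0->].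
  by rewrite addr0 /cofactor -signr_odd oddD addbb mul1r.
by rewrite mul0r.
Qed.

(** The chain of a loop s in Y lies in the cycle space of Y, so it is a multiple of the generator
    [z Y]; comparing s-entries, the factor is 1 or -1. *)
Lemma lambda_with_loop (G : graph) k (d : 'I_k -> chain G) b s z :
  cycle_choice z -> src s = tgt s ->
  exists a : int, lambda_with d b z s = edge_chain s *~ a.
Proof.
move=> zc loop; rewrite /lambda_with.
have Zs : Z1 (edge_chain s).
  by rewrite /Z1 boundary_edge_chain loop; apply/ffunP => v; rewrite !ffunE subrr.
apply: (big_ind (fun x => exists a : int, x = edge_chain s *~ a)).
- by exists 0.
- by move=> _ _ [a ->] [a' ->]; exists (a + a'); rewrite mulrzDr.
move=> Y /andP[Yct sY]; have zgen := cycle_choice_generator zc Yct.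
have [_ _ _ /(_ _ Zs) [e|a sa]] := zgen.
  by rewrite ffunE; case: eqP => [->|//]; rewrite sY.
have := congr1 (fun x : chain G => x s) sa.
rewrite /= ffun_intMz ffunE eqxx => /esym zsa.
have aa : a * a = 1.
  by have /eqP := congr1 absz zsa; rewrite abszM muln_eq1 => /andP[_ /eqP ?]; nia.
exists (a * winding d b (z Y)); by rewrite sa -mulrzA mulrA aa mul1r.
Qed.

Lemma lambda_with_contract (G : graph) k (d : 'I_k -> chain G)
    (b : 'I_k.+1 -> chain G) s (nl : src s != tgt s) z zc :
  Zbasis (@Z1 G) b -> cycle_choice z -> cycle_choice zc ->
  coords b (lambda_with d b z s) =
  coords (contract_basis nl b)
    (lambda (contract_unicyclizer nl b d) (contract_basis nl b) zc).
Proof.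
move=> [Zb b_indep b_span] z_choice zc_choice.
have Zlin c : Z1 (lincomb b c) by apply: sum_Z1.
have dropE c : drop_edge s (lincomb b c) = lincomb (contract_basis nl b) c.
  exact: raddf_lincomb.
have bc_indep : indep_mod (fun x => x = 0) (contract_basis nl b).
  move=> c; rewrite -dropE => /(Z1_contract_inj nl (Zlin c)).
  exact: b_indep.
have coordsE x : Z1 x -> coords (contract_basis nl b) (drop_edge s x) = coords b x.
  by case/b_span=> c ->; rewrite dropE !coords_lincomb.
rewrite -(coordsE _ (lambda_with_Z1 d b s z_choice)).
(* The factor 1 is the [n] of [lambda_transfer]. *)
congr (coords _ _); rewrite -[RHS]mulr1z.
pose h (Y' : {set edge (contract nl)}) := s |: lift_set Y'.
have := @lambda_transfer G (contract nl)
  (drop_edge s : {additive chain G -> chain (contract nl)})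
  (fun Y => s \in Y) h (@drop_set G s) z zc (winding d b)
  (winding (contract_unicyclizer nl b d) (contract_basis nl b)) 1; apply => //.
- by move=> Y'; apply: setU11.
- exact: contract_setK.
- exact: drop_set_contractK.
- exact: connected_contract.
- exact: cycle_iso_contract.
- by move=> y; apply: windingN.
move=> Y' x Zx _; rewrite mul1r /winding /contract_unicyclizer.
by rewrite coordmx_of_coordmx // coordsE.
Qed.

Lemma lambda_without_diff_row0 (G : graph) k (d : 'I_k -> chain G)
    (b : 'I_k.+1 -> chain G) s z :
  (forall j, Z1 (d j)) -> Zbasis (@Z1 G) b -> cycle_choice z ->
  diff_row d s = 0 -> lambda_without d b z s = 0.
Proof.
move=> Zd [Zb b_indep b_span] z_choice ds.
(* Multiplying coordinates by [r] returns the s-entry, so [r] kills the winding matrix when all its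
   columns belong to chains vanishing at s. *)
pose r : 'rV_k.+1 := \row_i b i s.
have rcoords x : Z1 x -> r *m coords b x = (x s)%:M.
  case/b_span => c ->; rewrite coords_lincomb // [RHS]mx11_scalar.
  rewrite [LHS]mx11_scalar !mxE eqxx mulr1n lincombE.
  by congr (_%:M); apply: eq_bigr => i _; rewrite mxE.
have rcoordmx : r *m coordmx b d = diff_row d s.
  apply/rowP => j; have := congr1 (fun M : 'M_1 => M 0 0) (rcoords _ (Zd j)).
  by rewrite !mxE eqxx mulr1n => <-; apply: eq_bigr => i _; rewrite !mxE.
apply: big1 => Y /andP[Yct sY].
have [Zz Yz _ _] := cycle_choice_generator z_choice Yct.
suff r0 : r != 0.
  rewrite /winding (det_row_killed r0) ?mulr0z //.
  apply: etrans (mul_mx_row r (coords b (z Y)) (coordmx b d)) _.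
  by rewrite rcoords // Yz // rcoordmx ds raddf0 row_mx0.
(* Y is connected and avoids s, so s closes up to a cycle chain with entry 1 at s, which a zero [r]
   could not return. *)
apply/eqP => r0.
have /edge_cycle_chain[x [Zx _ xs]] : connect (adj (Y :\ s)) (tgt s) (src s).
  have /andP[/andP[_ /forallP conn] _] := Yct.
  have -> : Y :\ s = Y by apply/setDidPl; rewrite disjoint_sym disjoints1.
  exact: (forallP (conn _)).
have := rcoords x Zx; rewrite r0 mul0mx xs => /matrixP/(_ 0 0).
by rewrite !mxE.
Qed.

(** The i-th cycle uses [e i], since otherwise it would lie in the tree, and no other [e j], since
    these are outside the tree. *)
Lemma fundamental_cycle_coef (G : graph) (T : {set edge G}) n (e : 'I_n -> edge G)
    (b : 'I_n -> chain G) : fundamental_cycles T e b ->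
  forall i j, (b i (e j) != 0) = (i == j).
Proof.
case=> [/andP[_ /eqP/cards0_eq Tcyc] e_inj eT be] i j.
have eNT l : e l \notin T by rewrite -in_setC -eT imset_f.
have [C CeT [_ bC]] := be i.
move: CeT; rewrite inE => /andP[Ccyc CeT].
rewrite -normr_eq0 bC; have [<-|ij] := eqVneq i j.
  have -> // : e i \in C.
  apply: contraT => eC; have : C \in cycles_of T.
    by rewrite inE Ccyc -(setU1K (eNT i)) subsetD1 CeT.
  by rewrite Tcyc inE.
have /negPf-> // : e j \notin C.
apply: contra ij => /(subsetP CeT); rewrite !inE (negPf (eNT j)) orbF.
by move/eqP/e_inj->.
Qed.

(** The s-entry of a cycle chain is a nonzero multiple of its last coordinate in [b']. Hence the
    cycle chains vanishing at s are spanned by the other members of [b'], which give a basis for the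
    deletion. *)
Lemma lambda_without_delete (G : graph) k (d : 'I_k -> chain G)
    (b : 'I_k.+1 -> chain G) s z (T : {set edge G}) (e : 'I_k.+1 -> edge G)
    (b' : 'I_k.+1 -> chain G) (U : 'M[int]_k) zd n :
  (0 < k)%N ->
  (forall j, Z1 (d j)) -> Zbasis (@Z1 G) b -> cycle_choice z ->
  fundamental_cycles T e b' -> e ord_max = s ->
  \det (coordmx b b') = 1 -> \det U = 1 ->
  last_row_reduced (reduced_mx b' d U) n -> cycle_choice zd ->
  let L := lambda_without d b z s in
  let Ld := lambda (delete_unicyclizer s b' d U) (delete_basis s b') zd in
  (forall i : 'I_k.-1.+1,
     coords b' L (row_emb i) 0 = n%:Z * coords (delete_basis s b') Ld i 0) /\
  coords b' L ord_max 0 = 0.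
Proof.
(* Writing k as a successor makes [row_emb] and [col_emb] the inclusions of all rows, respectively
   columns, but the last. *)
case: k d b e b' U => // k d b e b' U _ Zd bZ z_choice fund es det_b' detU Mn zd_choice.
have Zb' i : Z1 (b' i) by case: fund => _ _ _ /(_ i)[C _ []].
have b'Z : Zbasis (@Z1 G) b' by apply: Zbasis_change bZ Zb' det_b'.
have [_ b'_indep b'_span] := b'Z.
have b's (i : 'I_k.+1) : b' (@row_emb k.+1 i) s = 0.
  apply/eqP; rewrite -es -[_ == _]negbK (fundamental_cycle_coef fund).
  by rewrite -val_eqE /= neq_ltn ltn_ord.
have lincomb_s c : lincomb b' c s = b' ord_max s * c ord_max 0.
  rewrite lincombE big_ord_recr /= big1 ?add0r // => i _.
  by rewrite (_ : widen_ord _ i = @row_emb k.+1 i) ?b's ?mul0r //; apply: val_inj.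
have coords_last x : Z1 x -> x s = 0 -> coords b' x ord_max 0 = 0.
  case/b'_span => c ->; rewrite lincomb_s coords_lincomb // => /eqP.
  rewrite mulf_eq0 -es -[b' _ _ == 0]negbK (fundamental_cycle_coef fund) eqxx.
  by move/eqP.
pose db := delete_basis s b'.
have drop_lincomb (c : 'cV_k.+2) : c ord_max 0 = 0 ->
    drop_edge s (lincomb b' c) = lincomb db (\col_(i < k.+1) c (@row_emb k.+1 i) 0).
  move=> c0; rewrite raddf_lincomb /lincomb big_ord_recr /= c0 mulr0z addr0.
  apply: eq_bigr => i _; rewrite mxE.
  by rewrite (_ : widen_ord _ i = @row_emb k.+1 i) //; apply: val_inj.
have db_indep : indep_mod (fun x => x = 0) db.
  (* Padding [c] by a last coordinate 0 gives a combination vanishing at s, and on such chains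
     [drop_edge] is injective. *)
  move=> c c0; pose c' : 'cV_k.+2 := \col_i
    (if unlift ord_max i is Some j then c j 0 else 0).
  have c'E : \col_(i < k.+1) c' (@row_emb k.+1 i) 0 = c.
    apply/colP => i; rewrite !mxE; have -> : @row_emb k.+1 i = lift ord_max i.
      by apply: val_inj; rewrite /= /bump leqNgt ltn_ord.
    by rewrite liftK.
  have c'max : c' ord_max 0 = 0 by rewrite mxE unlift_none.
  rewrite -c'E (b'_indep c'); first by apply/colP => i; rewrite !mxE.
  apply: (drop_edge_inj (s := s)); first by rewrite lincomb_s c'max mulr0.
  by rewrite drop_lincomb // c'E.
have coords_drop x : Z1 x -> x s = 0 ->
    coords db (drop_edge s x) = \col_(i < k.+1) coords b' x (@row_emb k.+1 i) 0.
  move=> Zx xs; have x_last := coords_last x Zx xs.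
  by rewrite -{1}(coordsK b'_indep (b'_span x Zx)) drop_lincomb // coords_lincomb.
have windingE x : Z1 x -> x s = 0 ->
    winding d b x = n%:Z * winding (delete_unicyclizer s b' d U) db (drop_edge s x).
  (* Passing to [b'] and applying [U] both keep the determinant. The last row is then (0 ... 0 n):
     its first entry is the last coordinate of [x], zero because [x] vanishes at s, and the rest
     comes from the reduced matrix. *)
  move=> Zx xs; rewrite /winding (coords_change bZ Zb') //.
  rewrite (coordmx_change bZ Zb' det_b' Zd).
  rewrite -mul_mx_row det_mulmx det_b' mul1r -(det_row_mx_mulr _ _ detU).
  rewrite -/(reduced_mx b' d U) det_last_row => [|j].
    congr (_ * _).
      (* Behind the column of [x], column indices of the reduced matrix are shifted by one, so the
         corner is the entry n of its last column. *)
      rewrite mxE; case: splitP => [[[|//] ?] //|j jE].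
      by rewrite Mn -[j.+1]/(1 + j)%N -jE eqxx.
    congr (\det _); apply/matrixP => i j.
    rewrite coordmx_of_coordmx // coords_drop //.
    rewrite [LHS]mxE [LHS]mxE [LHS]mxE [RHS]mxE.
    have -> : lift ord_max i = @row_emb k.+1 i.
      by apply: val_inj; rewrite /= /bump leqNgt ltn_ord.
    have lift_j : lift ord_max j = j :> nat by rewrite /= /bump leqNgt ltn_ord.
    (* Index 0 is the column of the chain on both sides; the mixed cases would equate 0 with a
       successor. *)
    case: splitP => j1; rewrite lift_j => j1E; case: splitP => j2 j2E.
    - by rewrite mxE !ord1.
    - by have := ltn_ord j1; rewrite -j1E j2E.
    - by have := ltn_ord j2; rewrite -j2E j1E.
    - rewrite [RHS]mxE; congr (fun_of_matrix _ _ _); apply: val_inj.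
      by apply: (@addnI 1); rewrite -j1E j2E.
  move=> jm; rewrite mxE; case: splitP => [j' _|j' jE].
    by rewrite ord1 coords_last.
  rewrite Mn; case: eqP => // jk; case/negP: jm; apply/eqP/val_inj.
  by rewrite /= jE; apply: jk.
have db_span y : Z1 y -> exists c, y = lincomb db c.
  (* A cycle chain of the deletion extends by 0 at s to one of [G], whose last coordinate is 0. *)
  move=> Zy; have [_ _ /(_ y Zy)] := cycle_iso_delete (s := s) [set: edge (delete s)].
  case=> [f|x [Zx Yx <-]]; first by rewrite inE.
  have xs : x s = 0 by apply/Yx/notin_lift_set.
  have [c xE] := b'_span x Zx; exists (\col_(i < k.+1) c (@row_emb k.+1 i) 0).
  by rewrite xE drop_lincomb // -(coords_lincomb b'_indep c) -xE coords_last.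
move=> L Ld; have ZL : Z1 L by apply: lambda_without_Z1.
have Ls : L s = 0.
  rewrite sum_ffunE big1 // => Y /andP[Yct sY]; rewrite ffun_intMz.
  by have [_ -> //] := cycle_choice_generator z_choice Yct; rewrite mul0r.
split; last exact: coords_last.
have LLd : drop_edge s L = Ld *~ n.
  have := @lambda_transfer G (delete s)
    (drop_edge s : {additive chain G -> chain (delete s)})
    (fun Y => s \notin Y) (@lift_set G s) (@drop_set G s) z zd (winding d b)
    (winding (delete_unicyclizer s b' d U) db) n; apply => //.
  - exact: notin_lift_set.
  - exact: lift_setK.
  - exact: drop_setK.
  - exact: connected_delete.
  - exact: cycle_iso_delete.
  - by move=> y; apply: windingN.
  by move=> Y' x Zx Yx; apply: windingE => //; apply/Yx/notin_lift_set.
have ZLd : Z1 Ld.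
  by apply: sum_Z1 => Y; apply: cycle_choice_Z1.
move=> i; have /matrixP/(_ i 0) := coords_drop L ZL Ls; rewrite mxE => <-.
have [c LdE] := db_span Ld ZLd.
rewrite LLd -/db LdE -raddfMz !coords_lincomb // -scaler_int mxE.
by rewrite intz.
Qed.

Theorem proposition4p5p1 (G : graph) (k : nat) (d : 'I_k -> chain G)
    (b : 'I_k.+1 -> chain G) (s : edge G) (z : {set edge G} -> chain G) :
  connected_graph G -> unicyclizer d -> Zbasis (@Z1 G) b -> cycle_choice z ->
  [/\ src s = tgt s ->
        exists a : int, lambda_with d b z s = edge_chain s *~ a,
      forall (nl : src s != tgt s)
             (zc : {set edge (contract nl)} -> chain (contract nl)),
        cycle_choice zc ->
        coords b (lambda_with d b z s) =
        coords (contract_basis nl b)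
          (lambda (contract_unicyclizer nl b d) (contract_basis nl b) zc),
      diff_row d s = 0 -> lambda_without d b z s = 0
    & diff_row d s != 0 ->
      forall (T : {set edge G}) (e : 'I_k.+1 -> edge G)
             (b' : 'I_k.+1 -> chain G) (U : 'M[int]_k)
             (zd : {set edge (delete s)} -> chain (delete s)),
        fundamental_cycles T e b' -> e ord_max = s ->
        \det (coordmx b b') = 1 -> \det U = 1 ->
        last_row_reduced (reduced_mx b' d U) (winding_difference d s) ->
        cycle_choice zd ->
        let L := lambda_without d b z s in
        let Ld := lambda (delete_unicyclizer s b' d U) (delete_basis s b') zd in
        (forall i : 'I_k.-1.+1,
           coords b' L (row_emb i) 0 =
           (winding_difference d s)%:Z * coords (delete_basis s b') Ld i 0) /\
        coords b' L ord_max 0 = 0].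
Proof.
move=> _ [_ Zd _] bZ z_choice; split.
- exact: lambda_with_loop.
- by move=> nl zc zc_choice; apply: lambda_with_contract.
- exact: lambda_without_diff_row0.
move=> ds T e b' U zd fund es det_b' detU Mn zd_choice.
apply: (lambda_without_delete (k := k) (T := T) (e := e)) => //.
(* A nonzero row has at least one entry, so k is positive. *)
by rewrite lt0n; apply: contra_neq ds => k0; apply/rowP => j;
   have := ltn_ord j; rewrite {2}k0.
Qed.
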